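(* Let $\mathcal F=(V,\mathcal E\cup\mathcal A)$ be a finite mixed hypergraph, let $f,g:V\to\mathbb Z_+$ be functions and let $k,\ell,\ell'$ be positive integers. Put $g_k(v)=\min\{k,g(v)\}$ for $v\in V$. There exists an $(f,g)$-bounded $k$-regular $(\ell,\ell')$-limited packing of mixed hyperarborescences in $\mathcal F$ if and only if (i) $g_k(v)\ge f(v)$ for every $v\in V$, (ii) $\min\{g_k(V),\ell'\}\ge \ell$, and (iii) for every subpartition $\mathcal P$ of $V$, $$e_{\mathcal E\cup\mathcal A}(\mathcal P)\ \ge\ k|\mathcal P|-\min\{\ell'-f(V-\cup\mathcal P),\ g_k(\cup\mathcal P)\}.$$
   Context: For a function $h$ on $V$ and $X\subseteq V$, $h(X)=\sum_{v\in X}h(v)$. A subpartition of $V$ is a family of pairwise disjoint subsets of $V$; $\cup\mathcal P$ is the union of its members. A mixed hypergraph $\mathcal F=(V,\mathcal E\cup\mathcal A)$ has a (multi)set $\mathcal E$ of hyperedges (subsets of $V$ of size at least two) and a (multi)set $\mathcal A$ of dyperedges; a dyperedge is a pair $(Z,z)$ with head $z\in V$ and tail set $\emptyset\ne Z\subseteq V-z$. A hyperedge $X$ enters $Y\subseteq V$ if $X\cap Y\neq\emptyset\neq X-Y$; a dyperedge $(Z,z)$ enters $Y$ if $z\in Y$ and $Z-Y\neq\emptyset$. For a family $\mathcal P$ of subsets of $V$, $e_{\mathcal E\cup\mathcal A}(\mathcal P)$ is the number of hyperedges in $\mathcal E$ and dyperedges in $\mathcal A$ that enter some member of $\mathcal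 P$. Orienting a hyperedge $X$ replaces it by a dyperedge $(X-x,x)$ for some $x\in X$. Trimming a dyperedge $(Z,z)$ replaces it by an arc $yz$ with $y\in Z$. In a digraph, an $s$-arborescence is a subgraph containing $s$ in which every vertex is reachable from $s$ by a unique directed path; a packing of subgraphs is a set of arc-disjoint subgraphs; it is $k$-regular if every vertex of $V$ belongs to exactly $k$ of the subgraphs, $(f,g)$-bounded (for arborescences) if each $v\in V$ is the root of at least $f(v)$ and at most $g(v)$ arborescences of the packing, and $(\ell,\ell')$-limited if the packing has at least $\ell$ and at most $\ell'$ members. A dypergraph $(V,\mathcal A)$ has an $(f,g)$-bounded $k$-regular $(\ell,\ell')$-limited packing of hyperarborescences if its dyperedges can be trimmed to give a digraph $(V,A)$ having an $(f,g)$-bounded $k$-regular $(\ell,\ell')$-limited packing of arborescences. The mixed hypergraph $\mathcal F$ has an $(f,g)$-bounded $k$-regular $(\ell,\ell')$-limited packing of mixed hyperarborescences if $\mathcal E$ has an orientation $\vec{\mathcal E}$ such that the dypergraph $(V,\vec{\mathcal E}\cup\mathcal A)$ has an $(f,g)$-bounded $k$-regular $(\ell,\ell')$-limited packing of hyperarborescences.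
   Formalization: Members of a subpartition are taken to be nonempty (with an empty member allowed, (iii) would always fail), and a packing is a family in which the one-vertex arborescence may be repeated (as a set, the claim fails for one vertex with k=f=g=ℓ=ℓ'=2). *)

(* Defs.v *)
From HB Require Import structures.
From mathcomp Require Import all_boot all_order all_algebra.

Set Implicit Arguments.
Unset Strict Implicit.
Unset Printing Implicit Defensive.

(* Multisets of hyperedges, dyperedges and arcs are families indexed by a
   finite type, so parallel copies are distinct indices. *)

Record mixed_hypergraph (V : finType) := MixedHypergraph {
  mh_edge : finType;
  mh_dyper : finType;
  mh_vset : mh_edge -> {set V};
  mh_tail : mh_dyper -> {set V};
  mh_head : mh_dyper -> V;
  mh_vset_gt1 : forall e, 1 < #|mh_vset e|;
  mh_tail_neq0 : forall a, mh_tail a != set0;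
  mh_headNtail : forall a, mh_head a \notin mh_tail a
}.

Record dypergraph (V : finType) := Dypergraph {
  dy_edge : finType;
  dy_tail : dy_edge -> {set V};
  dy_head : dy_edge -> V;
  dy_tail_neq0 : forall d, dy_tail d != set0;
  dy_headNtail : forall d, dy_head d \notin dy_tail d
}.

Record digraph (V : finType) := Digraph {
  arc : finType;
  arc_tail : arc -> V;
  arc_head : arc -> V
}.

Section Entering.
Variable V : finType.

Definition hyperedge_enters (X Y : {set V}) : bool :=
  (X :&: Y != set0) && (X :\: Y != set0).

Definition dyperedge_enters (Z : {set V}) (z : V) (Y : {set V}) : bool :=
  (z \in Y) && (Z :\: Y != set0).

Definition entering_number (F : mixed_hypergraph V) (P : {set {set V}}) : nat :=
  #|[set e : mh_edge F | [exists Y in P, hyperedge_enters (mh_vset e) Y]]| +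
  #|[set a : mh_dyper F |
      [exists Y in P, dyperedge_enters (mh_tail a) (mh_head a) Y]]|.

(* Members are nonempty, as for partitions; being also pairwise disjoint they
   are distinct, so a set of sets suffices. The empty subpartition is allowed. *)
Definition subpartition (P : {set {set V}}) : bool :=
  trivIset P && (set0 \notin P).

Definition set_sum (h : V -> nat) (X : {set V}) : nat := \sum_(v in X) h v.

End Entering.

Section Orientation.
Variables (V : finType) (F : mixed_hypergraph V).

Definition is_orientation (o : mh_edge F -> V) : Prop :=
  forall e, o e \in mh_vset e.

Variable o : mh_edge F -> V.

Definition orient_tail (d : mh_edge F + mh_dyper F) : {set V} :=
  match d with inl e => mh_vset e :\ o e | inr a => mh_tail a end.

Definition orient_head (d : mh_edge F + mh_dyper F) : V :=
  match d with inl e => o e | inr a => mh_head a end.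

Lemma orient_tail_neq0 d : orient_tail d != set0.
Proof.
case: d => [e|a] /=; last exact: mh_tail_neq0.
rewrite -card_gt0; have := mh_vset_gt1 e.
by rewrite (cardsD1 (o e)); case: (_ \in _) => //= /ltnW.
Qed.

Lemma orient_headNtail d : orient_head d \notin orient_tail d.
Proof. by case: d => [e|a] /=; [rewrite setD11 | exact: mh_headNtail]. Qed.

Definition orient : dypergraph V :=
  Dypergraph orient_tail_neq0 orient_headNtail.

End Orientation.

Section Trimming.
Variables (V : finType) (D : dypergraph V).

Definition is_trimming (t : dy_edge D -> V) : Prop :=
  forall d, t d \in dy_tail d.

Definition trim (t : dy_edge D -> V) : digraph V :=
  Digraph t (@dy_head V D).

End Trimming.

Section Packing.
Variables (V : finType) (G : digraph V).

Record subgraph := Subgraph {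
  sg_vertices : {set V};
  sg_arcs : {set arc G};
  sg_incident : forall a, a \in sg_arcs ->
    (arc_tail a \in sg_vertices) && (arc_head a \in sg_vertices)
}.

Fixpoint dipath (B : {set arc G}) (s v : V) (p : seq (arc G)) : bool :=
  match p with
  | [::] => s == v
  | a :: q => [&& a \in B, arc_tail a == s & dipath B (arc_head a) v q]
  end.

(* A dipath is the sequence of its arcs, so parallel arcs give different paths.
   Distinctness of vertices is not imposed: uniqueness forces it, and uniqueness
   among vertex-simple paths only would let T contain arcs directed back towards
   s, e.g. both sv and vs. *)
Definition is_arborescence (s : V) (T : subgraph) : Prop :=
  s \in sg_vertices T /\
  forall v, v \in sg_vertices T -> exists! p, dipath (sg_arcs T) s v p.

(* A packing is an indexed family rather than a set of subgraphs, since the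
   trivial arborescence on one vertex may occur several times in it. *)
Definition arborescence_packing (m : nat) (T : 'I_m -> subgraph)
    (r : 'I_m -> V) : Prop :=
  (forall i, is_arborescence (r i) (T i)) /\
  (forall i j, i != j -> [disjoint sg_arcs (T i) & sg_arcs (T j)]).

Definition bounded_packing (f g : V -> nat) (m : nat) (r : 'I_m -> V) : Prop :=
  forall v, f v <= #|[set i | r i == v]| <= g v.

Definition regular_packing (k m : nat) (T : 'I_m -> subgraph) : Prop :=
  forall v, #|[set i | v \in sg_vertices (T i)]| = k.

Definition limited_packing (l l' m : nat) : Prop := l <= m <= l'.

Definition has_arborescence_packing (f g : V -> nat) (k l l' : nat) : Prop :=
  exists (m : nat) (T : 'I_m -> subgraph) (r : 'I_m -> V),
    [/\ arborescence_packing T r, bounded_packing f g r,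
        regular_packing k T & limited_packing l l' m].

End Packing.

Definition has_hyperarborescence_packing (V : finType) (D : dypergraph V)
    (f g : V -> nat) (k l l' : nat) : Prop :=
  exists t : dy_edge D -> V,
    is_trimming t /\ has_arborescence_packing (trim t) f g k l l'.

Definition has_mixed_hyperarborescence_packing (V : finType)
    (F : mixed_hypergraph V) (f g : V -> nat) (k l l' : nat) : Prop :=
  exists o : mh_edge F -> V,
    is_orientation o /\ has_hyperarborescence_packing (orient o) f g k l l'.

(* Main.v *)
Require Import Defs.
From mathcomp Require Import all_boot all_order all_algebra.
From mathcomp Require Import zify.

Set Implicit Arguments.
Unset Strict Implicit.
Unset Printing Implicit Defensive.

(* Necessity: each member of a subpartition needs, for each of the k trees
   through one of its vertices, a root inside or an entering arc.

   Sufficiency: call root numbers r feasible if k|P| <= r(cover P) + e(P) for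
   every subpartition P.  The two families obtained from subpartitions P and Q
   (components of their union, nonempty pairwise intersections) satisfy
   |P| + |Q| <= |P'| + |Q'| and e(P') + e(Q') <= e(P) + e(Q), so tight
   subpartitions can be uncrossed.  Starting from r = min(k, g), lower r while
   it stays feasible and r(V) > l'; if this got stuck with r(V) > l', the tight
   subpartition with largest cover would violate (iii).  With r fixed,
   uncrossing two tight subpartitions shows that one of any two candidate heads
   (then tails) of a hyperedge can be discarded.  The resulting digraph
   satisfies Edmonds' condition once r(v) arcs are added from a source to each
   v, and Lovasz's argument yields k spanning arborescences from the source;
   since r(v) <= k, arcs entering v can be traded for unused source arcs, so
   that v becomes a root exactly r(v) times. *)

(** * Subpartitions *)

Section Subpartitions.
Variable V : finType.
Implicit Types (A B C X Y Z : {set V}) (P Q : {set {set V}}).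

Lemma subpartitionP P :
  reflect ((forall A B x, A \in P -> B \in P -> x \in A -> x \in B -> A = B) /\
           set0 \notin P)
          (subpartition P).
Proof.
apply: (iffP andP) => -[disjP P0]; split=> //.
  move=> A B x PA PB Ax Bx; apply: contraTeq Bx => neqAB.
  by rewrite (disjointFr _ Ax) //; apply: (trivIsetP disjP).
apply/trivIsetP => A B PA PB; apply: contraR => /pred0Pn[x /andP[/= Ax Bx]].
by apply/eqP; apply: (disjP A B x).
Qed.

Lemma subpartition0 : subpartition (set0 : {set {set V}}).
Proof. by apply/subpartitionP; split=> [A B x|]; rewrite in_set0. Qed.

Lemma subpartition1 X : X != set0 -> subpartition [set X].
Proof.
move=> X0; apply/subpartitionP; split; last by rewrite in_set1 eq_sym.
by move=> A B x /set1P-> /set1P->.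
Qed.

Lemma cover1 X : cover [set X] = X.
Proof. by rewrite /cover big_set1. Qed.

Definition meets P Q : {set {set V}} :=
  [set A :&: B | A in P, B in Q] :\ set0.

Lemma meetsP P Q W :
  reflect (exists A B, [/\ A \in P, B \in Q, W = A :&: B & W != set0])
          (W \in meets P Q).
Proof.
apply: (iffP setD1P) => [[W0 /imset2P[A B PA QB defW]] | [A [B [PA QB -> W0]]]].
  by exists A, B.
by split=> //; apply/imset2P; exists A B.
Qed.

Lemma subpartition_meets P Q :
  subpartition P -> subpartition Q -> subpartition (meets P Q).
Proof.
move=> /subpartitionP[dP P0] /subpartitionP[dQ Q0]; apply/subpartitionP.
split; last by apply/meetsP => -[A [B [_ _ _ /eqP]]].
move=> _ _ x /meetsP[A [B [PA QB -> _]]] /meetsP[C [D [PC QD -> _]]].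
by move=> /setIP[xA xB] /setIP[xC xD]; rewrite (dP A C x) // (dQ B D x).
Qed.

Lemma cover_meets P Q : cover (meets P Q) = cover P :&: cover Q.
Proof.
apply/setP=> x; apply/bigcupP/setIP => [[W /meetsP[A [B [PA QB -> _]]]]|[]].
  by case/setIP=> xA xB; split; apply/bigcupP; [exists A | exists B].
case/bigcupP=> A PA xA /bigcupP[B QB xB]; have xAB : x \in A :&: B.
  by apply/setIP.
exists (A :&: B) => //; apply/meetsP; exists A, B; split=> //.
by apply/set0Pn; exists x.
Qed.

(** A nonempty intersection determines both its factors, so this counts the edges of the bipartite
    graph joining the meeting members of [P] and [Q]. *)
Lemma card_meets P Q : subpartition P -> subpartition Q ->
  #|meets P Q| = \sum_(B in Q) #|[set A in P | A :&: B != set0]|.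
Proof.
move=> /subpartitionP[dP P0] /subpartitionP[dQ Q0].
pose S := [set p : {set V} * {set V} |
  [&& p.2 \in Q, p.1 \in P & p.1 :&: p.2 != set0]].
have -> : meets P Q = [set p.1 :&: p.2 | p in S].
  apply/setP=> W; apply/meetsP/imsetP => [[A [B [PA QB -> W0]]]|].
    by exists (A, B); rewrite // inE /= PA QB.
  case=> [[A B]]; rewrite inE /= => /and3P[QB PA W0] ->.
  by exists A, B.
rewrite card_in_imset; last first.
  move=> [A B] [C D]; rewrite !inE /= => /and3P[QB PA /set0Pn[x xAB]].
  case/and3P=> QD PC _ eqW; have := xAB; rewrite eqW => /setIP[xC xD].
  by case/setIP: xAB => xA xB; rewrite (dP A C x) // (dQ B D x).
rewrite -sum1_card.
rewrite (eq_bigr (fun B => \sum_(A | (A \in P) && (A :&: B != set0)) 1)).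
  rewrite pair_big_dep /=.
  rewrite (reindex_onto (fun p => (p.2, p.1)) (fun p => (p.2, p.1))) /=.
    by apply: eq_bigl => -[A B]; rewrite !inE /= eqxx andbT.
  by case.
by move=> B _; rewrite -sum1_card; apply: eq_bigl => A; rewrite inE.
Qed.

(* The partition into connected components of the bipartite graph on P and Q
   joining the meeting members: it has at least |P| + |Q| - #edges components.
   Built by merging the members of Q one at a time. *)
Lemma subpartition_join P Q : subpartition P -> subpartition Q ->
  exists P', [/\ subpartition P', cover P' = cover P :|: cover Q,
    forall C, C \in P :|: Q -> exists2 Z, Z \in P' & C \subset Z &
    #|P| + #|Q| <= #|P'| + #|meets P Q|].
Proof.
move=> sP; move: {2}#|Q| (erefl #|Q|) => n; elim: n Q => [|n IHn] Q.
  move/eqP; rewrite cards_eq0 => /eqP-> _; exists P; split=> //.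
  - by rewrite /cover big_set0 setU0.
  - by move=> C; rewrite setU0 => PC; exists C.
  by rewrite cards0 addn0 leq_addr.
move=> cQ sQ; have [B QB] : exists B, B \in Q.
  by apply/set0Pn; rewrite -card_gt0 cQ.
set Q0 := Q :\ B; have defQ : Q = B |: Q0 by rewrite setD1K.
have nQ0B : B \notin Q0 by rewrite setD11.
have [dQ nQ0] := subpartitionP _ sQ; have [dP nP0] := subpartitionP _ sP.
have sQ0 : subpartition Q0.
  apply/subpartitionP; split; last by rewrite inE negb_and nQ0 orbT.
  by move=> C D x /setD1P[_ QC] /setD1P[_ QD]; apply: dQ.
have cQ0 : #|Q0| = n by move: cQ; rewrite defQ cardsU1 nQ0B => -[].
have [P0 [sP0 cP0 subP0 leP0]] := IHn Q0 cQ0 sQ0.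
have [dP0 nP00] := subpartitionP _ sP0.
have B0 : B != set0 by apply: contraNneq nQ0 => <-.
(* [B] fuses the components it meets, those in [M], into the single component [Z]; those in [N]
   survive. *)
pose M := [set A in P0 | A :&: B != set0]; pose N := P0 :\: M.
pose Z := B :|: cover M.
have meetN x A : A \in N -> x \in A -> x \notin Z.
  case/setDP=> PA; rewrite inE PA negbK => /eqP AB0 xA.
  rewrite inE negb_or; apply/andP; split.
    by apply: contra_eqN AB0 => xB; apply/set0Pn; exists x; rewrite inE xA.
  apply/bigcupP=> -[C]; rewrite inE => /andP[PC CB0] xC.
  by rewrite -(dP0 A C x) // AB0 eqxx in CB0.
have nNZ : Z \notin N.
  have [x xB] := set0Pn _ B0; apply/negP => /(meetN x).
  by rewrite inE xB => /(_ isT).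
exists (Z |: N); split.
- apply/subpartitionP; split; last first.
    rewrite in_setU1 negb_or; apply/andP; split.
      by rewrite eq_sym setU_eq0 negb_and B0.
    by apply/negP => /setDP[]; rewrite (negPf nP00).
  move=> A C x /setU1P[->|NA] /setU1P[->|NC] // xA xC.
  + by rewrite (negPf (meetN _ _ NC xC)) in xA.
  + by rewrite (negPf (meetN _ _ NA xA)) in xC.
  by apply: (dP0 A C x) => //; [case/setDP: NA | case/setDP: NC].
- rewrite /cover bigcup_setU big_set1 -/(cover N) -/(cover P) -/(cover Q).
  have -> : cover Q = B :|: cover Q0.
    by rewrite defQ /cover bigcup_setU big_set1.
  rewrite setUCA -cP0 /Z -setUA; congr (_ :|: _).
  have -> : cover P0 = cover (M :|: N).
    congr cover; apply/setP=> A; rewrite !inE.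
    by case: (A \in P0) => //=; case: (_ == _).
  by rewrite /cover bigcup_setU.
- have toZ C : (exists2 D, D \in P0 & C \subset D) ->
    exists2 D, D \in Z |: N & C \subset D.
    case=> D PD sCD; case MD: (D \in M).
      exists Z; first by rewrite setU11.
      by apply: subset_trans (subsetUr _ _); apply: (bigcup_max D).
    by exists D; rewrite // in_setU1 in_setD MD PD orbT.
  move=> C; rewrite defQ setUCA => /setU1P[->|PC]; last exact/toZ/subP0.
  by exists Z; rewrite ?setU11 // subsetUl.
rewrite cardsU1 nNZ card_meets // defQ big_setU1 //= -card_meets //.
rewrite cardsU1 nQ0B.
have sMP : M \subset P0 by apply/subsetP=> A; rewrite inE => /andP[].
have := cardsID M P0; rewrite (setIidPr sMP) -/N.
(* Members of [Q0] are disjoint from [B], so a component in [M] meets [B] inside some member of [P].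
   Hence the components lost by the fusion are paid for by the new intersections with [B]. *)
suff: #|M| <= #|[set A in P | A :&: B != set0]|.
  move: leP0; rewrite !add1n; clear; move: #|M| #|N| #|P| #|Q0| #|P0|.
  by move: #|meets P Q0| #|[set A in P | _]|; lia.
pose up A := odflt set0 [pick D in P0 | A \subset D].
rewrite -(_ : up @: [set A in P | A :&: B != set0] :&: M = M).
  by apply: leq_trans (leq_imset_card up _); apply/subset_leq_card/subsetIl.
apply/setIidPr/subsetP => D; rewrite inE => /andP[PD /set0Pn[x /setIP[xD xB]]].
have : x \in cover P0 by apply/bigcupP; exists D.
rewrite cP0 => /setUP[] /bigcupP[A]; last first.
  by case/setD1P=> neAB QA xA; rewrite (dQ A B x) ?eqxx in neAB.
move=> PA xA; apply/imsetP; exists A.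
  by rewrite inE PA; apply/set0Pn; exists x; apply/setIP.
rewrite /up; case: pickP => [D' /andP[PD' sAD'] | noD] /=.
  by apply: (dP0 D D' x); rewrite // (subsetP sAD').
have [|D' PD' sAD'] := subP0 A; first by rewrite inE PA.
by have := noD D'; rewrite PD' sAD'.
Qed.

Lemma set_sum_modular (h : V -> nat) X Y :
  set_sum h (X :|: Y) + set_sum h (X :&: Y) = set_sum h X + set_sum h Y.
Proof.
rewrite /set_sum (big_setID Y) /= [\sum_(v in X) _](big_setID Y) /=.
rewrite setIUl setIid setDUl setDv setU0 (setUidPr (subsetIr X Y)); lia.
Qed.

End Subpartitions.

(** * Uncrossing tight subpartitions *)

Section Entering.
Variable V : finType.
Implicit Types (A B C X Y Z T H : {set V}) (P Q : {set {set V}}).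

(* A hyperedge X is the case T = H = X, a dyperedge (Z, z) the case T = Z,
   H = [set z]: T and H hold the tails and heads still allowed. *)
Definition enters_some T H P : bool :=
  [exists Y in P, (H :&: Y != set0) && (T :\: Y != set0)].

Lemma enters_someP T H P :
  reflect (exists Y h t, [/\ Y \in P, h \in H, h \in Y, t \in T & t \notin Y])
          (enters_some T H P).
Proof.
apply: (iffP existsP) => [[Y /and3P[PY]]|[Y [h [t [PY Hh Yh Tt nYt]]]]].
  move=> /set0Pn[h /setIP[Hh Yh]] /set0Pn[t /setDP[Tt nYt]].
  by exists Y, h, t.
exists Y; rewrite PY /=; apply/andP; split; apply/set0Pn.
  by exists h; apply/setIP.
by exists t; apply/setDP.
Qed.

(* Submodularity of [enters_some] in P can fail for other pairs T, H. *)
Definition trimmable T H := H \subset T \/ exists h, H = [set h].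

(** A head in a meet lies in some [A] of [P] and [B] of [Q]. If [P'] is entered too, neither [A] nor
    [B] contains [T]: otherwise it would contain the head entering [P'], by trimmability, and also
    the tail supposed to lie outside that component. If only [P'] is entered, the member of [P] or
    [Q] around the head is entered by the same tail. *)
Lemma enters_some_submodular T H P Q P' : trimmable T H ->
  subpartition P' -> cover P' = cover P :|: cover Q ->
  (forall C, C \in P :|: Q -> exists2 Z, Z \in P' & C \subset Z) ->
  enters_some T H P' + enters_some T H (meets P Q) <=
    enters_some T H P + enters_some T H Q.
Proof.
move=> okTH /subpartitionP[dP' _] cP' subP'.
have inP' C h : C \in P :|: Q -> h \in C -> h \in H -> enters_some T H P' ->
    (enters_some T H (meets P Q) -> exists2 t, t \in T & t \notin C).
  move=> PC Ch Hh /enters_someP[Z [h' [t' [PZ Hh' Zh' Tt' nZt']]]] _.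
  apply/subsetPn; apply: contra nZt' => sTC.
  have Ch' : h' \in C.
    case: okTH Hh Hh' => [sHT _ Hh'|[h0 ->] /set1P<- /set1P->] //.
    by apply: (subsetP sTC); apply: (subsetP sHT).
  have [Z' PZ' sCZ'] := subP' _ PC.
  by rewrite (dP' Z Z' h') ?(subsetP sCZ') // (subsetP sTC).
case: (boolP (enters_some T H (meets P Q))) inP' => [mPQ|_] inP'.
  have [W [h [t [/meetsP[A [B [PA QB -> _]]] Hh /setIP[Ah Bh] Tt]]]] :=
    enters_someP _ _ _ mPQ.
  rewrite inE negb_and => ntAB.
  case: (boolP (enters_some T H P')) inP' => [eP'|_] inP'; last first.
    case/orP: ntAB => nt.
      by have -> : enters_some T H P by apply/enters_someP; exists A, h, t.
    have -> : enters_some T H Q by apply/enters_someP; exists B, h, t.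
    exact: leq_addl.
  have [|tA TtA nAtA] := inP' A h _ Ah Hh isT isT; first by rewrite inE PA.
  have [|tB TtB nBtB] := inP' B h _ Bh Hh isT isT; first by rewrite inE QB orbT.
  have -> : enters_some T H P by apply/enters_someP; exists A, h, tA.
  by have -> : enters_some T H Q by apply/enters_someP; exists B, h, tB.
rewrite addn0; case: (boolP (enters_some T H P')) => //.
case/enters_someP=> [Z [h [t [PZ Hh Zh Tt nZt]]]].
have [C PC Ch] : exists2 C, C \in P :|: Q & h \in C.
  have : h \in cover P' by apply/bigcupP; exists Z.
  by rewrite cP' /cover -bigcup_setU => /bigcupP.
have [Z' PZ' sCZ'] := subP' _ PC.
have nCt : t \notin C.
  apply: contra nZt => Ct; rewrite (dP' Z Z' h) ?(subsetP sCZ') //.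
case/setUP: PC => PC.
  by have -> : enters_some T H P by apply/enters_someP; exists C, h, t.
have -> : enters_some T H Q by apply/enters_someP; exists C, h, t.
exact: leq_addl.
Qed.

End Entering.

(** * Feasible root numbers; choosing heads, tails and roots *)

Section Families.
Variables (V E : finType) (k : nat).
Implicit Types (r : V -> nat) (T H : E -> {set V}).
Implicit Types (X : {set V}) (P Q : {set {set V}}).

Definition entering T H P : nat := \sum_e enters_some (T e) (H e) P.

Definition feasible r T H : bool :=
  [forall P : {set {set V}}, subpartition P ==>
    (k * #|P| <= set_sum r (cover P) + entering T H P)].

Definition tight r T H P : bool :=
  subpartition P && (k * #|P| == set_sum r (cover P) + entering T H P).

Lemma feasibleP r T H :
  reflect (forall P, subpartition P ->
             k * #|P| <= set_sum r (cover P) + entering T H P)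
          (feasible r T H).
Proof.
by apply: (iffP forallP) => h P; [move/implyP: (h P) | apply/implyP/h].
Qed.

Lemma eq_feasible r T H T' H' : T =1 T' -> H =1 H' ->
  feasible r T H = feasible r T' H'.
Proof.
move=> eT eH; apply: eq_forallb => P; congr (_ ==> (_ <= _ + _)).
by apply: eq_bigr => e _; rewrite eT eH.
Qed.

Lemma entering_set0 T H : entering T H set0 = 0.
Proof.
apply: big1 => e _; apply/eqP; rewrite eqb0; apply/enters_someP.
by case=> [Y [h [t []]]]; rewrite inE.
Qed.

Lemma tight_set0 r T H : tight r T H set0.
Proof.
rewrite /tight subpartition0 cards0 muln0 entering_set0.
by rewrite /cover /set_sum !big_set0.
Qed.

(** Adding the two tight equations and comparing with feasibility of [P'] and of [meets P Q] forces
    equality throughout. The submodular inequality is then an equality for each single [e], which is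
    what decides the choice of heads and tails. *)
Lemma tight_uncross r T H P Q : (forall e, trimmable (T e) (H e)) ->
  feasible r T H -> tight r T H P -> tight r T H Q ->
  exists P', [/\ tight r T H P', cover P' = cover P :|: cover Q,
    forall C, C \in P :|: Q -> exists2 Z, Z \in P' & C \subset Z &
    forall e, enters_some (T e) (H e) P' + enters_some (T e) (H e) (meets P Q)
            = enters_some (T e) (H e) P + enters_some (T e) (H e) Q].
Proof.
move=> okTH /feasibleP feas /andP[sP /eqP tP] /andP[sQ /eqP tQ].
have [P' [sP' cP' subP' leP']] := subpartition_join sP sQ.
have sM := subpartition_meets sP sQ.
have sub e := enters_some_submodular (okTH e) sP' cP' subP'.
have fP' := feas _ sP'; have fM := feas _ sM.
have modr := set_sum_modular r (cover P) (cover Q).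
rewrite -cP' -cover_meets in modr.
have lek : k * #|P| + k * #|Q| <= k * #|P'| + k * #|meets P Q|.
  by rewrite -!mulnDr leq_mul2l leP' orbT.
have le_e : entering T H P' + entering T H (meets P Q) <=
    entering T H P + entering T H Q.
  by rewrite -!big_split; apply: leq_sum => e _; apply: sub.
exists P'; split=> //.
  apply/andP; split=> //; apply/eqP; move: le_e lek modr fP' fM tP tQ; clear.
  move: (entering T H P') (entering T H P) (entering T H Q).
  move: (entering T H (meets P Q)) (k * _) (k * _) (k * _) (k * _).
  by move: (set_sum _ _) (set_sum _ _) (set_sum _ _) (set_sum _ _); lia.
move=> e0; apply/eqP; rewrite eqn_leq sub /= leqNgt; apply/negP => lt_e0.
have: entering T H P' + entering T H (meets P Q) <
    entering T H P + entering T H Q.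
  rewrite -!big_split /= (bigD1 e0) //= [ltnRHS](bigD1 e0) //=.
  by rewrite -addSn leq_add // leq_sum.
move: lek modr fP' fM tP tQ; clear.
move: (entering T H P') (entering T H P) (entering T H Q).
move: (entering T H (meets P Q)) (k * _) (k * _) (k * _) (k * _).
by move: (set_sum _ _) (set_sum _ _) (set_sum _ _) (set_sum _ _); lia.
Qed.

(** A change at [e0] alone lowers [entering] by at most one, so a newly violated subpartition was
    tight and has just lost [e0]. *)
Lemma tight_of_infeasible r T H T' H' e0 :
  (forall e, e != e0 -> T' e = T e) -> (forall e, e != e0 -> H' e = H e) ->
  feasible r T H -> ~~ feasible r T' H' ->
  exists P, [/\ tight r T H P, enters_some (T e0) (H e0) P &
                ~~ enters_some (T' e0) (H' e0) P].
Proof.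
move=> eT eH /feasibleP feas; rewrite negb_forall => /existsP[P].
rewrite negb_imply -ltnNge => /andP[sP ltP]; exists P; have := feas P sP.
move: ltP; rewrite /tight sP /entering (bigD1 e0) //.
rewrite [X in _ -> _ <= _ + X -> _](bigD1 e0) //=.
rewrite [X in _ == _ + X](bigD1 e0) //=.
rewrite (eq_bigr (fun e => enters_some (T e) (H e) P : nat)); last first.
  by move=> e ne; rewrite eT ?eH.
move: (\sum_(_ | _) _) (set_sum _ _) (k * _) => a b c.
case: (enters_some (T e0) _ P); case: (enters_some _ _ P) => /= lt_bc le_cb.
all: by split=> //; lia.
Qed.

(** Heads are discarded one at a time. If neither [x] nor [y] can go, there are tight [P] and [Q],
    entered by [e0], whose covers contain no head of [e0] but [x] and [y] respectively. The
    uncrossing equality makes [e0] enter [meets P Q], whose heads would have to equal both. *)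
Lemma feasible_choose_heads r T H : (forall e, trimmable (T e) (H e)) ->
  (forall e, H e != set0) -> feasible r T H ->
  exists h : E -> V,
    (forall e, h e \in H e) /\ feasible r T (fun e => [set h e]).
Proof.
have [n] := ubnP (\sum_e #|H e|); elim: n H => // n IHn H leH okTH H0 feas.
have [|/forallPn[e0]] := boolP [forall e, #|H e| <= 1].
  move/forallP=> H1; have: forall e, exists h, H e = [set h].
    by move=> e; apply/cards1P; rewrite eqn_leq H1 card_gt0 H0.
  case/fin_all_exists=> h defH; exists h; split=> [e|].
    by rewrite defH set11.
  by rewrite -(@eq_feasible r T H).
rewrite -ltnNge => /card_gt1P[x [y [Hx Hy neq_xy]]].
have sHT : H e0 \subset T e0.
  case: (okTH e0) => // -[z defH]; move: Hx Hy neq_xy.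
  by rewrite defH => /set1P-> /set1P->; rewrite eqxx.
pose H' z e := if e == e0 then H e0 :\ z else H e.
have H'ne z e : e != e0 -> H' z e = H e by rewrite /H' => /negPf->.
have H'e0 z : H' z e0 = H e0 :\ z by rewrite /H' eqxx.
have IH z : z \in [set x; y] -> feasible r T (H' z) -> exists h : E -> V,
    (forall e, h e \in H e) /\ feasible r T (fun e => [set h e]).
  move=> xyz feasz; have Hz : z \in H e0 by case/set2P: xyz => ->.
  have sH' e : H' z e \subset H e.
    by rewrite /H'; case: eqP => // ->; apply: subD1set.
  case: (IHn (H' z)) => // [||e|h [Hh fh]].
  - rewrite -ltnS; apply: leq_trans leH; rewrite ltnS.
    rewrite (bigD1 e0) //= [ltnRHS](bigD1 e0) //=.
    rewrite -addSn H'e0 (cardsD1 z (H e0)) Hz; apply: leq_add; first by [].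
    apply: leq_sum => e ne.
    by rewrite H'ne.
  - move=> e; case: (eqVneq e e0) => [->|ne]; last by rewrite H'ne.
    by left; rewrite H'e0; apply: subset_trans sHT; apply: subD1set.
  - rewrite /H'; case: (e =P e0) => _; last exact: H0.
    apply/set0Pn; case/set2P: xyz => ->.
      by exists y; rewrite !inE eq_sym neq_xy.
    by exists x; rewrite !inE neq_xy.
  by exists h; split=> // e; apply: (subsetP (sH' e)).
have tightz z : ~~ feasible r T (H' z) ->
    exists P, [/\ tight r T H P, enters_some (T e0) (H e0) P &
                  forall w, w \in H e0 -> w \in cover P -> w = z].
  move=> nfz; have [P [tP eP neP]] :=
    tight_of_infeasible (fun e _ => erefl (T e)) (H'ne z) feas nfz.
  (* Another head [w] in a member [Yw] would keep [P] entered. Either some tail avoids [Yw], or [Yw]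
     contains all tails, hence the old head [h] as well; then [Yw] is [Y], which misses the tail
     [t]. *)
  exists P; split=> // w Hw /bigcupP[Yw PYw Yww].
  apply: contraNeq neP => neq_wz; rewrite H'e0; apply/enters_someP.
  have [Y [h [t [PY Hh Yh Tt nYt]]]] := enters_someP _ _ _ eP.
  case: (eqVneq h z) => [eq_hz|ne_hz]; last first.
    by exists Y, h, t; split=> //; rewrite !inE ne_hz.
  have [sTYw|/subsetPn[t' Tt' nYt']] := boolP (T e0 \subset Yw); last first.
    by exists Yw, w, t'; split=> //; rewrite !inE neq_wz.
  have [/subpartitionP[dP _] _] := andP tP; case/negP: nYt.
  rewrite (dP Y Yw h) ?(subsetP sTYw) //.
  exact: (subsetP sHT).
have [/IH|/tightz[P [tP eP HP]]] := boolP (feasible r T (H' x)).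
  by apply; rewrite set21.
have [/IH|/tightz[Q [tQ eQ HQ]]] := boolP (feasible r T (H' y)).
  by apply; rewrite set22.
have [P' [_ _ _ /(_ e0)]] := tight_uncross okTH feas tP tQ.
rewrite eP eQ; case: (boolP (enters_some _ _ (meets P Q))); last first.
  by case: (enters_some _ _ P').
case/enters_someP=> [Y [h [_ [MY Hh Yh _ _]]]] _.
have : h \in cover (meets P Q) by apply/bigcupP; exists Y.
rewrite cover_meets => /setIP[Ph Qh].
by rewrite -(HP h) // -(HQ h) // eqxx in neq_xy.
Qed.

(** If neither [x] nor [y] can be discarded, a tight [P] has a member [A] holding the head and all
    tails but [x], and a tight [Q] a member [B] holding the head and all tails but [y]. The
    uncrossing equality makes [e0] enter [P'], but the member of [P'] around the head contains [A]
    and [B], hence all tails. *)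
Lemma feasible_choose_tails r T (h : E -> V) : (forall e, T e != set0) ->
  feasible r T (fun e => [set h e]) ->
  exists t : E -> V, (forall e, t e \in T e) /\
    feasible r (fun e => [set t e]) (fun e => [set h e]).
Proof.
have [n] := ubnP (\sum_e #|T e|); elim: n T => // n IHn T leT T0 feas.
have [|/forallPn[e0]] := boolP [forall e, #|T e| <= 1].
  move/forallP=> T1; have: forall e, exists t, T e = [set t].
    by move=> e; apply/cards1P; rewrite eqn_leq T1 card_gt0 T0.
  case/fin_all_exists=> t defT; exists t; split=> [e|].
    by rewrite defT set11.
  by rewrite -(@eq_feasible r T (fun e => [set h e])).
rewrite -ltnNge => /card_gt1P[x [y [Tx Ty neq_xy]]].
pose T' z e := if e == e0 then T e0 :\ z else T e.
have T'ne z e : e != e0 -> T' z e = T e by rewrite /T' => /negPf->.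
have T'e0 z : T' z e0 = T e0 :\ z by rewrite /T' eqxx.
have IH z : z \in [set x; y] -> feasible r (T' z) (fun e => [set h e]) ->
    exists t : E -> V, (forall e, t e \in T e) /\
    feasible r (fun e => [set t e]) (fun e => [set h e]).
  move=> xyz feasz; have Tz : z \in T e0 by case/set2P: xyz => ->.
  case: (IHn (T' z)) => // [|e|t [Tt ft]].
  - rewrite -ltnS; apply: leq_trans leT; rewrite ltnS.
    rewrite (bigD1 e0) //= [ltnRHS](bigD1 e0) //=.
    rewrite -addSn T'e0 (cardsD1 z (T e0)) Tz; apply: leq_add; first by [].
    apply: leq_sum => e ne.
    by rewrite T'ne.
  - rewrite /T'; case: (e =P e0) => _; last exact: T0.
    apply/set0Pn; case/set2P: xyz => ->.
      by exists y; rewrite !inE eq_sym neq_xy.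
    by exists x; rewrite !inE neq_xy.
  exists t; split=> // e; have := Tt e.
  by rewrite /T'; case: eqP => // -> /setD1P[].
have tightz z : ~~ feasible r (T' z) (fun e => [set h e]) ->
    exists P, [/\ tight r T (fun e => [set h e]) P,
      enters_some (T e0) [set h e0] P &
      exists A, [/\ A \in P, h e0 \in A & T e0 :\ z \subset A]].
  move=> nfz; have [P [tP eP neP]] :=
    tight_of_infeasible (T'ne z) (fun e _ => erefl [set h e]) feas nfz.
  exists P; split=> //.
  have [A [h' [t [PA /set1P-> Ah Tt nAt]]]] := enters_someP _ _ _ eP.
  exists A; split=> //; apply: contraR neP => /subsetPn[t' Tt' nAt'].
  by apply/enters_someP; exists A, (h e0), t'; rewrite T'e0 set11.
have [/IH|/tightz[P [tP eP [A [PA Ah sTA]]]]] :=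
  boolP (feasible r (T' x) (fun e => [set h e])); first by apply; rewrite set21.
have [/IH|/tightz[Q [tQ eQ [B [QB Bh sTB]]]]] :=
  boolP (feasible r (T' y) (fun e => [set h e])); first by apply; rewrite set22.
have okTH e : trimmable (T e) [set h e] by right; exists (h e).
have [P' [tP' _ subP' /(_ e0)]] := tight_uncross okTH feas tP tQ.
rewrite eP eQ; case: (boolP (enters_some _ _ P')); last first.
  by case: (enters_some _ _ (meets P Q)).
case/enters_someP=> [Z [_ [t [PZ /set1P-> Zh Tt nZt]]]] _; case/negP: nZt.
have [/subpartitionP[dP' _] _] := andP tP'.
have inZ C : C \in P :|: Q -> h e0 \in C -> t \in C -> t \in Z.
  move=> PC Ch Ct; have [Z' PZ' sCZ'] := subP' _ PC.
  by rewrite (dP' Z Z' (h e0)) ?(subsetP sCZ').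
case: (eqVneq t x) => [tx|ntx].
  apply: (inZ B) => //; first by rewrite inE QB orbT.
  by apply: (subsetP sTB); rewrite !inE Tt tx neq_xy.
apply: (inZ A) => //; first by rewrite inE PA.
by apply: (subsetP sTA); rewrite !inE Tt ntx.
Qed.

Lemma set_sum_decr r v X : 0 < r v ->
  set_sum r X = set_sum (fun u => r u - (u == v)) X + (v \in X).
Proof.
move=> rv; have -> : (v \in X : nat) = \sum_(u in X) (u == v).
  case: (boolP (v \in X)) => [Xv|nXv].
    rewrite (bigD1 v) //= eqxx big1 // => u /andP[_ /negPf->] //.
  by rewrite big1 // => u Xu; case: eqP => // uv; rewrite -uv Xu in nXv.
rewrite /set_sum -big_split; apply: eq_bigr => u _ /=.
by case: eqP => [->|_]; rewrite ?subn0 ?addn0 ?subnK.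
Qed.

Lemma feasible_choose_roots T H (f g : V -> nat) l l' :
  (forall e, trimmable (T e) (H e)) -> (forall v, f v <= g v) ->
  l <= set_sum g [set: V] -> l <= l' -> feasible g T H ->
  (forall P, subpartition P ->
     k * #|P| + set_sum f (~: cover P) <= entering T H P + l') ->
  exists r : V -> nat, [/\ forall v, f v <= r v <= g v,
    l <= set_sum r [set: V] <= l' & feasible r T H].
Proof.
move=> okTH le_fg le_lg le_ll' feas_g le_f.
suff main n r : set_sum r [set: V] <= n -> (forall v, f v <= r v <= g v) ->
    l <= set_sum r [set: V] -> feasible r T H ->
    exists r : V -> nat, [/\ forall v, f v <= r v <= g v,
      l <= set_sum r [set: V] <= l' & feasible r T H].
  by apply: (main _ g (leqnn _)) => // v; rewrite le_fg /=.
elim: n r => [|n IHn] r le_rn frg le_lr feas.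
  by exists r; split; rewrite // le_lr (leq_trans le_rn).
have [le_rl'|lt_l'r] := leqP (set_sum r [set: V]) l'.
  by exists r; split; rewrite // le_lr.
have [|/forallPn[v]] := boolP [forall v, (f v < r v) ==>
    [exists P : {set {set V}}, tight r T H P && (v \in cover P)]].
  (* The empty subpartition is tight, so a tight one with largest cover exists. By uncrossing it
     absorbs every vertex with [f v < r v], so [r] agrees with [f] outside the cover. *)
  move/forallP=> allt; have t0 := tight_set0 r T H.
  have [P tP maxP] := @arg_maxnP _ _ (tight r T H) (fun P => #|cover P|) t0.
  have inP v : v \notin cover P -> r v = f v.
    move=> nPv; apply/eqP; rewrite eqn_leq; case/andP: (frg v) => -> _.
    rewrite andbT leqNgt; apply: contra nPv => lt_fr.
    have /existsP[Q /andP[tQ Qv]] := implyP (allt v) lt_fr.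
    have [P' [tP' cP' _ _]] := tight_uncross okTH feas tP tQ.
    have sPP' : cover P \subset cover P' by rewrite cP' subsetUl.
    have /eqP-> : cover P == cover P' by rewrite eqEcard sPP'; apply: maxP.
    by rewrite cP' inE Qv orbT.
  have [sP /eqP eP] := andP tP; have := le_f P sP.
  have -> : set_sum f (~: cover P) = set_sum r (~: cover P).
    by apply: eq_bigr => v; rewrite inE => /inP.
  have : set_sum r [set: V] = set_sum r (cover P) + set_sum r (~: cover P).
    by rewrite /set_sum (big_setID (cover P)) setTI -setTD.
  move: eP lt_l'r; clear; move: (entering _ _ _) (set_sum r _) (k * _).
  by move=> a b c; move: (set_sum _ _) (set_sum _ _); lia.
rewrite negb_imply => /andP[lt_fr /existsPn not_tight].
have rv : 0 < r v by apply: leq_ltn_trans lt_fr.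
have decr X := set_sum_decr X rv.
have decrT := decr [set: V]; rewrite inE in decrT.
apply: (IHn (fun u => r u - (u == v))).
- by move: decrT le_rn; clear; move: (set_sum _ _) (set_sum _ _); lia.
- move=> u; have := frg u; case: (eqVneq u v) => [->|_]; last by rewrite subn0.
  by move: lt_fr; clear; move: (f v) (r v) (g v); lia.
- move: decrT lt_l'r le_ll'; clear.
  by move: (set_sum _ _) (set_sum _ _); lia.
(* Only subpartitions covering [v] lose a unit, and none of them is tight. *)
apply/feasibleP => P sP; have := not_tight P; have := feasibleP _ _ _ feas P sP.
rewrite /tight sP decr; case: (v \in cover P) => /=; rewrite ?andbT ?addn0 //.
by move: (set_sum _ _) (entering _ _ _) (k * _); lia.
Qed.

End Families.

(** * Edmonds' theorem *)

Section Branchings.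
(* An arc with tail [None] leaves a source outside V. *)
Variables (V E : finType) (k : nat) (tl : E -> option V) (hd : E -> V).
Implicit Types (X Y : {set V}) (A : {set E}) (R : 'I_k -> {set V}).

Definition tail_in X e : bool := oapp (fun u => u \in X) false (tl e).

Definition in_degree A X : nat :=
  \sum_(e in A) ((hd e \in X) && ~~ tail_in X e).

(** With [R i] the set already reached by the i-th branching, this counts the branchings that still
    have to enter [X]. *)
Definition demand R X : nat := \sum_i [disjoint R i & X].

Lemma in_degree_submodular A X Y :
  in_degree A (X :&: Y) + in_degree A (X :|: Y) <= in_degree A X + in_degree A Y.
Proof.
rewrite -!big_split; apply: leq_sum => e _ /=; rewrite /tail_in.
case: (tl e) => [u|] /=; rewrite !inE ?andbT; last by do 2!case: (hd e \in _).
by case: (hd e \in X); case: (hd e \in Y); case: (u \in X); case: (u \in Y).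
Qed.

Lemma disjoint_supermodular (B X Y : {set V}) :
  [disjoint B & X] + [disjoint B & Y] <=
    [disjoint B & X :&: Y] + [disjoint B & X :|: Y].
Proof.
rewrite -!setI_eq0 setIUr setU_eq0.
case: (boolP (B :&: X == set0)) => [/eqP BX0|_] /=.
  by rewrite setIA BX0 set0I eqxx leq_add2l.
case: (boolP (B :&: Y == set0)) => [/eqP BY0|_] //=.
by rewrite setICA BY0 setI0 eqxx.
Qed.

Lemma demand_supermodular R X Y :
  demand R X + demand R Y <= demand R (X :&: Y) + demand R (X :|: Y).
Proof. by rewrite -!big_split leq_sum // => i _; apply: disjoint_supermodular. Qed.

Lemma demand_supermodular_strict R X Y i :
  ~~ [disjoint R i & X] -> ~~ [disjoint R i & Y] -> [disjoint R i & X :&: Y] ->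
  demand R X + demand R Y < demand R (X :&: Y) + demand R (X :|: Y).
Proof.
move=> niX niY iXY; rewrite -!big_split (bigD1 i) //= [ltnRHS](bigD1 i) //=.
rewrite (negPf niX) (negPf niY) iXY -addSn leq_add // leq_sum // => j _.
exact: disjoint_supermodular.
Qed.

Definition covers A R : Prop :=
  forall X, X != set0 -> demand R X <= in_degree A X.

Definition extend R i v j : {set V} := if j == i then v |: R i else R j.

(* Lovasz's exchange argument: an arc leaving [R i] inside an inclusionwise
   minimal tight set that meets [R i] can be given to the i-th branching. *)
Lemma covers_extend A R i : covers A R -> R i != setT ->
  exists e, [/\ e \in A, hd e \notin R i, tl e = None \/ tail_in (R i) e &
    covers (A :\ e) (extend R i (hd e))].
Proof.
move=> cov RiT.
pose dangerous X := [&& in_degree A X == demand R X, ~~ [disjoint R i & X] &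
  ~~ (X \subset R i)].
(* Giving [e] to branching [i] costs an entering arc only for sets entered by [e]. Such a set is
   harmed only if it was tight and its demand does not drop, because it already meets [R i]. *)
have step e : e \in A -> hd e \notin R i ->
    (forall Y, dangerous Y -> hd e \in Y -> tail_in Y e) ->
    covers (A :\ e) (extend R i (hd e)).
  move=> Ae nRe safe Y Y0; have := cov Y Y0.
  rewrite /in_degree (bigD1 e) //= -/(in_degree _ _).
  have -> : \sum_(e' in A | e' != e) ((hd e' \in Y) && ~~ tail_in Y e') =
      in_degree (A :\ e) Y.
    by apply: eq_bigl => e'; rewrite !inE andbC.
  rewrite /demand (bigD1 i) //= [X in _ -> X <= _](bigD1 i) //= /extend eqxx.
  rewrite [X in _ -> _ + X <= _]
    (eq_bigr (fun j => [disjoint R j & Y] : nat)); last first.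
    by move=> j /negPf->.
  have -> : [disjoint hd e |: R i & Y] = (hd e \notin Y) && [disjoint R i & Y].
    by rewrite !disjoints_subset subUset sub1set inE.
  set s := \sum_(_ | _) _; set d := in_degree _ _ => le_sd.
  have [/andP[eY nYe]|] := boolP ((hd e \in Y) && ~~ tail_in Y e); last first.
    move=> ne; rewrite (negPf ne) add0n in le_sd.
    by apply: leq_trans le_sd; rewrite leq_add2r; case: (_ \in Y).
  rewrite eY /= add0n; move: le_sd; rewrite eY nYe /=.
  have [//|niY] := boolP [disjoint R i & Y]; rewrite add0n leq_eqVlt.
  case/orP=> [/eqP eq_sd|]; last by rewrite add1n ltnS.
  case/negP: (nYe); apply: safe => //; rewrite /dangerous niY.
  apply/and3P; split=> //.
    apply/eqP; rewrite /in_degree (bigD1 e) //= eY nYe.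
    rewrite /demand (bigD1 i) //= (negPf niY) add0n -/s eq_sd; congr (_ + _).
    by apply: eq_bigl => e'; rewrite !inE andbC.
  by apply/subsetPn; exists (hd e).
(* Without dangerous sets, any arc entering the complement of [R i] will do. *)
have [X0 dX0|nod] := pickP dangerous; last first.
  have nRi0 : ~: R i != set0 by rewrite -subset0 -setCT setCS subTset.
  have : 0 < in_degree A (~: R i).
    apply: leq_trans (cov _ nRi0); rewrite /demand (bigD1 i) //=.
    by rewrite -subsets_disjoint subxx.
  rewrite lt0n sum_nat_eq0 => /forall_inPn[e Ae].
  rewrite eqb0 negbK inE => /andP[nRe nte]; exists e; split=> //.
    case etl: (tl e) => [u|]; [right | by left].
    by move: nte; rewrite /tail_in etl /= inE negbK.
  by apply: step => // Y; rewrite nod.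
have [X /and3P[/eqP tX niX nXR] minX] := arg_minnP (fun X => #|X|) dX0.
pose Y0 := X :\: R i; have Y00 : Y0 != set0 by rewrite setD_eq0.
(* Removing [R i] from [X] raises the demand, since branching [i] must now enter. Hence some arc
   enters [Y0] without entering [X]; its tail lies in both [X] and [R i]. *)
have lt_deg : in_degree A X < in_degree A Y0.
  apply: leq_trans (cov _ Y00); rewrite tX /demand.
  rewrite (bigD1 i) //= [ltnRHS](bigD1 i) //=.
  have -> : [disjoint R i & Y0].
    by rewrite disjoint_sym disjoints_subset subsetDr.
  rewrite (negPf niX) add0n ltnS leq_sum // => j _.
  have [diX|//] := boolP [disjoint R j & X].
  by rewrite (disjointWr _ diX) // subsetDl.
have [/exists_inP[e Ae]|/exists_inPn noe] := boolP [exists e in A,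
    [&& hd e \in Y0, ~~ tail_in Y0 e &
        ~~ ((hd e \in X) && ~~ tail_in X e)]]; last first.
  move: lt_deg; rewrite ltnNge; case/negP; apply: leq_sum => e Ae.
  have := noe e Ae; case: (hd e \in Y0); case: (tail_in Y0 e) => //=.
  by case: (_ && _).
case/and3P=> eY0 ntY0; have [eX nRe] := setDP eY0; rewrite eX negbK => tXe.
have tRe : tail_in (R i) e.
  move: ntY0 tXe; rewrite /tail_in; case: (tl e) => //= u.
  by rewrite inE => /nandP[|/negPf->//]; rewrite negbK.
exists e; split=> //; first by right.
apply: step => // Y /and3P[/eqP tY niY nYR] eY; apply/idPn => ntY.
have eXY : hd e \in X :&: Y by rewrite inE eX.
have XY0 : X :&: Y != set0 by apply/set0Pn; exists (hd e).
have XUY0 : X :|: Y != set0 by apply/set0Pn; exists (hd e); rewrite inE eX.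
have le1 := cov _ XY0; have le2 := cov _ XUY0.
have sub := in_degree_submodular A X Y; rewrite tX tY in sub.
(* A dangerous [Y] entered by [e] would give the dangerous set [X :&: Y], smaller than [X] because
   it misses the tail of [e]. Strict supermodularity ensures that it still meets [R i]. *)
have : dangerous (X :&: Y).
  apply/and3P; split.
  - have := demand_supermodular R X Y; move: sub le1 le2; clear.
    move: (in_degree _ _) (in_degree _ _) (demand _ _) (demand _ _) => a b c d.
    by move: (demand _ _) (demand _ _); lia.
  - apply/negP => /(demand_supermodular_strict niX niY).
    move: sub le1 le2; clear.
    move: (in_degree _ _) (in_degree _ _) (demand _ _) (demand _ _) => a b c d.
    by move: (demand _ _) (demand _ _); lia.
  by apply/subsetPn; exists (hd e).
move/minX; apply/negP; rewrite -ltnNge; apply: proper_card.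
apply/properP; split; first exact: subsetIl.
move: tXe ntY; rewrite /tail_in; case: (tl e) => //= u Xu nYu.
by exists u; rewrite // inE Xu.
Qed.

(** [col] hands each arc to at most one branching, and [rank], which decreases along parents outside
    [R i], certifies acyclicity. The induction enlarges the sets [R i] until all are full. *)
Lemma covers_branchings A R : covers A R ->
  exists (col : E -> option 'I_k) (rank : 'I_k -> V -> nat),
    forall i v, v \notin R i -> exists e,
      [/\ e \in A, col e = Some i, hd e = v &
          forall u, tl e = Some u -> u \notin R i -> rank i u < rank i v].
Proof.
have [n] := ubnP (\sum_i #|~: R i|); elim: n A R => // n IHn A R ltn cov.
have [/forallP allT|/forallPn[i RiT]] := boolP [forall i, R i == setT].
  exists (fun _ => None), (fun _ _ => 0) => i v.
  by rewrite (eqP (allT i)) inE.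
have [e [Ae nRe te cov']] := covers_extend cov RiT.
have [|col [rank brP]] := IHn _ _ _ cov'.
  rewrite -ltnS; apply: leq_trans ltn; rewrite ltnS.
  rewrite (bigD1 i) //= [ltnRHS](bigD1 i) //= -addSn; apply: leq_add.
    by apply: proper_card; rewrite /extend eqxx properC properUr // sub1set.
  by apply: leq_sum => j ji; rewrite /extend (negPf ji).
(* The vertex just attached to [R i] gets rank 0 and the other ranks of branching [i] shift up, so
   it may serve as a parent. *)
pose rank' j v :=
  if j == i then if v == hd e then 0 else (rank i v).+1 else rank j v.
exists (fun e' => if e' == e then Some i else col e'), rank' => j v nRv.
have [/andP[/eqP ji /eqP ve]|jv] := boolP ((j == i) && (v == hd e)).
  exists e; split=> //; rewrite ?eqxx ?ji // => u tu.
  by case: te; rewrite /tail_in tu //= => ->.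
have nR'v : v \notin extend R i (hd e) j.
  rewrite /extend; case: eqP jv nRv => [-> /= nve nRv|//].
  by rewrite in_setU1 negb_or nve.
have [e' [/setD1P[ne' Ae'] ce' he' re']] := brP j v nR'v.
exists e'; split=> //; first by rewrite (negPf ne').
move=> u tu nRu; rewrite /rank'; case: (eqVneq j i) jv => [eji /= nve|nji _].
  rewrite (negPf nve); case: eqVneq => // nue; rewrite ltnS -eji.
  by apply: re' => //; rewrite /extend eji eqxx in_setU1 negb_or nue -eji.
by apply: re' => //; rewrite /extend (negPf nji).
Qed.

End Branchings.

(** * From branchings to packings of arborescences *)

Lemma superset_of_card (T : finType) (A : {set T}) n :
  #|A| <= n <= #|T| -> exists2 B : {set T}, A \subset B & #|B| = n.
Proof.
case/andP; elim: n => [|n IHn] leAn lenT.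
  by exists A => //; apply/eqP; rewrite -leqn0.
move: leAn; rewrite leq_eqVlt => /predU1P[eqAn|ltAn]; first by exists A.
have [B sAB cB] := IHn ltAn (ltnW lenT).
have [x nBx] : exists x, x \in ~: B.
  by apply/set0Pn; rewrite -card_gt0; have := cardsC B; lia.
exists (x |: B); first exact: subset_trans (subsetUr _ _).
by rewrite cardsU1 -in_setC nBx cB.
Qed.

Lemma card_set_enum_val (T : finType) (S : {set T}) (Q : pred T) :
  #|[set i : 'I_#|S| | Q (enum_val i)]| = #|[set x in S | Q x]|.
Proof.
rewrite -(card_imset _ enum_val_inj).
apply: eq_card => x; rewrite inE; apply/imsetP/andP => [[i]|[Sx Qx]].
  by rewrite inE => Qi ->; split=> //; apply: enum_valP.
by exists (enum_rank_in Sx x); rewrite ?inE enum_rankK_in.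
Qed.

Section Packings.
Variables (V : finType) (G : digraph V).
Implicit Types (B : {set Defs.arc G}) (s v : V) (a : Defs.arc G).
Implicit Types (p q : seq (Defs.arc G)).

Lemma dipath_rcons B s v p a :
  dipath B s v (rcons p a) =
    [&& dipath B s (arc_tail a) p, a \in B & arc_head a == v].
Proof.
elim: p s => [|b p IHp] s /=; first by rewrite eq_sym andbCA.
by rewrite IHp !andbA.
Qed.

(** Read backwards from [v], a path has no choice: at most one arc of [B] enters each vertex, and
    none enters [s]. *)
Lemma dipath_unique B s v p q : {in B &, injective (@arc_head V G)} ->
  (forall a, a \in B -> arc_head a != s) ->
  dipath B s v p -> dipath B s v q -> p = q.
Proof.
move=> injB nBs; elim/last_ind: p v q => [|p a IHp] v q.
  move=> /eqP<-; case/lastP: q => // q b; rewrite dipath_rcons.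
  by case/and3P=> _ /nBs/negPf->.
rewrite dipath_rcons => /and3P[pa Ba /eqP ha]; case/lastP: q => [/eqP sv|q b].
  by have := nBs a Ba; rewrite ha -sv eqxx.
rewrite dipath_rcons => /and3P[qb Bb /eqP hb].
have eab : a = b by apply: injB => //; rewrite ha.
by rewrite -eab in qb *; rewrite (IHp _ _ pa qb).
Qed.

Variables (k : nat) (r : V -> nat).
Hypothesis le_rk : forall v, r v <= k.

(** [par i v] is the parent arc of [v] in the i-th spanning forest, [None] at a root. The source
    arcs into [v] are the pairs [(v, j)] with [j < r v]. *)
Lemma forests_of_demand :
  (forall X : {set V}, X != set0 -> k <= set_sum r X +
     \sum_(a : Defs.arc G) ((arc_head a \in X) && (arc_tail a \notin X))) ->
  exists (par : 'I_k -> V -> option (Defs.arc G)) (rank : 'I_k -> V -> nat),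
  [/\ forall v, #|[set i | par i v == None]| = r v,
      forall i v a, par i v = Some a ->
        arc_head a = v /\ rank i (arc_tail a) < rank i v &
      forall i j v a, par i v = Some a -> par j v = Some a -> i = j].
Proof.
move=> demX; pose E := (Defs.arc G + V * 'I_k)%type.
pose tl (e : E) := if e is inl a then Some (arc_tail a) else None.
pose hd (e : E) := match e with inl a => arc_head a | inr p => p.1 end.
pose A := [set e : E | if e is inr p then p.2 < r p.1 else true].
have cov : covers tl hd A (fun _ : 'I_k => set0).
  move=> X /demX; have -> : demand (fun _ : 'I_k => set0) X = k.
    rewrite /demand (eq_bigr (fun _ => 1)) ?sum1_card ?card_ord // => i _.
    by rewrite -setI_eq0 set0I eqxx.
  move/leq_trans; apply; rewrite addnC /in_degree big_sumType /=.
  apply: leq_add.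
    by apply: eq_leq; apply: eq_big => [a|a _]; rewrite ?inE.
  rewrite (eq_bigl (fun p : V * 'I_k => predT p.1 && (p.2 < r p.1))); last first.
    by move=> p; rewrite inE.
  rewrite -(pair_big_dep predT (fun v (j : 'I_k) => j < r v)
    (fun v j => ((v \in X) && ~~ tail_in tl X (inr (v, j))) : nat)) /=.
  rewrite /set_sum big_mkcond; apply: leq_sum => v _.
  case: ifP => // Xv; rewrite -(big_ord_widen k (fun _ => 1)) //.
  by rewrite sum1_card card_ord.
have [col [rank brP]] := covers_branchings cov.
have /fin_all_exists[par0 par0P] (p : 'I_k * V) : exists e : E,
    [/\ e \in A, col e = Some p.1, hd e = p.2 &
        forall u, tl e = Some u -> rank p.1 u < rank p.1 p.2].
  have [|e [Ae ce he re]] := brP p.1 p.2; first by rewrite inE.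
  by exists e; split=> // u tu; apply: re; rewrite ?inE.
pose U v := [set i | ~~ isSome (tl (par0 (i, v)))].
have leU v : #|U v| <= r v <= #|'I_k|.
  rewrite card_ord le_rk andbT.
  (* For [i] in [U v] this is the index of the source arc used by branching [i], never the default.
     Distinct branchings use distinct arcs, so [U v] has at most [r v] elements. *)
  pose num i := if par0 (i, v) is inr p then p.2 else i.
  rewrite -(@card_in_imset _ _ num); last first.
    move=> i j; rewrite !inE /num.
    have [_ ci hi _] := par0P (i, v); have [_ cj hj _] := par0P (j, v).
    case ei: (par0 (i, v)) ci hi => [//|[vi ni]] /= ci hi.
    case ej: (par0 (j, v)) cj hj => [//|[vj nj]] /= cj hj _ _ enij.
    by move: ci; rewrite hi enij -hj cj => -[].
  have <- : #|[set j : 'I_k | j < r v]| = r v.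
    rewrite -sum1_card (eq_bigl (fun j : 'I_k => j < r v)); last first.
      by move=> j; rewrite inE.
    by rewrite -(big_ord_widen k (fun _ => 1)) // sum1_card card_ord.
  apply: subset_leq_card; apply/subsetP => _ /imsetP[i Ui ->].
  move: Ui; rewrite !inE /num; have [] := par0P (i, v).
  by case: (par0 (i, v)) => [//|[vi ni]] /=; rewrite inE /= => ? _ <-.
(* Dropping the arc into [v] in further branchings makes [v] a root exactly [r v] times. *)
have /fin_all_exists2[U' sUU' cU'] := fun v => superset_of_card (leU v).
pose par i v := if i \in U' v then None else
  if par0 (i, v) is inl a then Some a else None.
have parP i v a : par i v = Some a -> par0 (i, v) = inl a.
  by rewrite /par; case: ifP => // _; case: (par0 _) => // b [->].
exists par, rank; split.
- move=> v; rewrite -cU'; apply: eq_card => i.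
  rewrite inE /par; case: ifP => // nU'i.
  have := contra (subsetP (sUU' v) i); rewrite nU'i => /(_ isT).
  by rewrite inE negbK; case: (par0 _).
- move=> i v a /parP pia; have [_ _ hi ri] := par0P (i, v).
  by split; [rewrite pia in hi | apply: ri; rewrite pia].
move=> i j v a /parP pi /parP pj.
have [_ ci _ _] := par0P (i, v); have [_ cj _ _] := par0P (j, v).
by move: ci; rewrite pi -pj cj => -[].
Qed.

(** The packing consists of the trees of the [k] forests, indexed by pairs of a root and a forest.
    Each vertex lies in one tree per forest, which gives regularity. *)
Lemma packing_of_demand :
  (forall X : {set V}, X != set0 -> k <= set_sum r X +
     \sum_(a : Defs.arc G) ((arc_head a \in X) && (arc_tail a \notin X))) ->
  exists (m : nat) (T : 'I_m -> subgraph G) (ro : 'I_m -> V),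
  [/\ arborescence_packing T ro, forall v, #|[set i | ro i == v]| = r v,
      regular_packing k T & m = set_sum r [set: V]].
Proof.
move=> /forests_of_demand[par [rank [rootP parP parI]]].
pose st i v := if par i v is Some a then arc_tail a else v.
have st_id n i v : par i v = None -> iter n (st i) v = v.
  by move=> pv; elim: n => //= n ->; rewrite /st pv.
have st_par n i v : rank i v <= n -> par i (iter n (st i) v) = None.
  elim: n v => [|n IHn] v le_rn.
    case pv: (par i v) => [a|]; last by [].
    by have [_] := parP _ _ _ pv; move: le_rn; rewrite leqn0 => /eqP->.
  case pv: (par i v) => [a|]; last by rewrite st_id.
  have [_ lt_r] := parP _ _ _ pv; rewrite iterSr {2}/st pv; apply: IHn.
  by rewrite -ltnS (leq_trans lt_r).
(* [N] bounds all ranks, so [N] parent steps reach the root from any vertex; roots are fixed by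
   [st]. *)
pose N := \max_(p : 'I_k * V) rank p.1 p.2; pose root i v := iter N (st i) v.
have root_par i v : par i (root i v) = None.
  exact/st_par/(leq_bigmax (i, v)).
have root_st i v : root i (st i v) = root i v.
  by rewrite /root -iterSr iterS {1}/st -/(root i v) root_par.
have root_tail i v a : par i v = Some a -> root i (arc_tail a) = root i v.
  by move=> pv; rewrite -(root_st i v) /st pv.
pose verts (p : V * 'I_k) := [set v | root p.2 v == p.1].
pose arcs (p : V * 'I_k) :=
  [set a | (par p.2 (arc_head a) == Some a) && (root p.2 (arc_head a) == p.1)].
have inc (p : V * 'I_k) a :
    a \in arcs p -> (arc_tail a \in verts p) && (arc_head a \in verts p).
  by rewrite !inE => /andP[/eqP /root_tail-> ->].
pose S := [set p : V * 'I_k | par p.2 p.1 == None].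
pose tree (p : V * 'I_k) := Subgraph (inc p).
exists #|S|, (fun j => tree (enum_val j)), (fun j => (enum_val j).1); split.
- split=> [j|j j' ne_jj'].
    have := enum_valP j; move: (enum_val j) => [s i]; rewrite inE /= => /eqP ps.
    split=> [|v]; first by rewrite inE /= /root st_id.
    rewrite inE /= => /eqP rv.
        suff [p pv] : exists p, dipath (arcs (s, i)) s v p.
      exists p; split=> // q qv; apply: dipath_unique pv qv => [a b|a].
        rewrite !inE /= => /andP[/eqP pa _] /andP[/eqP pb _] eab.
        by move: pa; rewrite eab pb => -[].
      rewrite inE /= => /andP[/eqP pa _].
      by apply: contra_eqN ps => /eqP<-; rewrite pa.
    have [n] := ubnP (rank i v); elim: n v rv => // n IHn v rv le_rn.
    case pv: (par i v) => [a|]; last first.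
      by exists [::]; rewrite /= -rv /root st_id.
    have [ha lt_r] := parP _ _ _ pv.
    have [||p pa] := IHn (arc_tail a); first by rewrite (root_tail _ _ _ pv).
      exact: leq_trans lt_r _.
    by exists (rcons p a); rewrite dipath_rcons pa inE /= ha pv rv !eqxx.
  apply/pred0P => a; apply/negP => /andP[/=]; rewrite !inE.
  case/andP=> /eqP pa ra /andP[/eqP pa' ra'].
  case/eqP: ne_jj'; apply: enum_val_inj.
  have ei := parI _ _ _ _ pa pa'; move: ra ra'; rewrite ei => /eqP ra /eqP ra'.
  by apply/eqP; rewrite -pair_eqE /= /pair_eq -ra -ra' ei !eqxx.
- move=> v; rewrite (card_set_enum_val S (fun p : V * 'I_k => p.1 == v)) -rootP.
  transitivity #|[set (v, i) | i in [set i | par i v == None]]|.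
    apply: eq_card => -[u i]; rewrite !inE /=.
    apply/andP/imsetP => [[pu /eqP uv]|[j]].
      by exists i; rewrite ?inE -?uv.
    by rewrite inE => pj [-> ->].
  by rewrite card_imset // => i j [].
- move=> v; rewrite (card_set_enum_val S (fun p : V * 'I_k => v \in verts p)).
  transitivity #|[set (root i v, i) | i : 'I_k]|.
    apply: eq_card => -[u i]; rewrite !inE /=.
    apply/andP/imsetP => [[_ /eqP<-]|[j _ [-> ->]]]; first by exists i.
    by rewrite root_par !eqxx.
  by rewrite card_imset ?card_ord // => i j [].
rewrite -sum1_card /set_sum.
rewrite (eq_bigl (fun p : V * 'I_k => predT p.1 && (par p.2 p.1 == None))); last first.
  by move=> p; rewrite inE.
rewrite -(pair_big_dep predT (fun v i => par i v == None) (fun _ _ => 1)) /=.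
apply: eq_big => [v|v _]; rewrite ?inE // -rootP -sum1_card.
by apply: eq_bigl => i; rewrite inE.
Qed.
End Packings.

(** * Packings in mixed hypergraphs *)

Lemma sum_unique (I : finType) (b : pred I) :
  (forall i j, b i -> b j -> i = j) -> \sum_i b i <= [exists i, b i].
Proof.
move=> b_uniq; have [/existsP[i bi]|/existsPn nb] := boolP [exists i, b i].
  rewrite (bigD1 i) //= bi big1 // => j ji; apply/eqP; rewrite eqb0.
  by apply: contra ji => bj; rewrite (b_uniq j i).
by rewrite big1 // => i _; rewrite (negPf (nb i)).
Qed.

Section Digraphs.
Variables (V : finType) (G : digraph V).
Implicit Types (Y : {set V}) (P : {set {set V}}).

Let arcT (a : Defs.arc G) := [set arc_tail a].
Let arcH (a : Defs.arc G) := [set arc_head a].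

Lemma enters_some_arc P a :
  enters_some (arcT a) (arcH a) P =
    [exists Y, (Y \in P) && (arc_head a \in Y) && (arc_tail a \notin Y)].
Proof.
apply/enters_someP/existsP => [[Y [h [t [PY /set1P-> Yh /set1P-> nYt]]]]|[Y]].
  by exists Y; rewrite PY Yh.
case/andP=> /andP[PY Yh] nYt; exists Y, (arc_head a), (arc_tail a).
by rewrite !set11.
Qed.

Lemma entering_arcs1 Y :
  entering arcT arcH [set Y] =
    \sum_(a : Defs.arc G) ((arc_head a \in Y) && (arc_tail a \notin Y)).
Proof.
apply: eq_bigr => a _; rewrite enters_some_arc; congr nat_of_bool.
apply/existsP/andP => [[Z /andP[/andP[/set1P->]]]|[hY tY]] //.
by exists Y; rewrite set11 hY.
Qed.

Lemma dipath_enters (B : {set Defs.arc G}) Y s v p :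
  dipath B s v p -> s \notin Y -> v \in Y ->
  exists a, [/\ a \in B, arc_head a \in Y & arc_tail a \notin Y].
Proof.
elim: p s => [|a p IHp] s /=; first by move/eqP->; move/negPf->.
case/and3P=> Ba /eqP<- pv nYs Yv.
have [Ya|nYa] := boolP (arc_head a \in Y); first by exists a.
exact: IHp pv nYa Yv.
Qed.

Variables (k m : nat) (T : 'I_m -> subgraph G) (ro : 'I_m -> V).
Hypotheses (packT : arborescence_packing T ro) (regT : regular_packing k T).

Let nroots v := #|[set i | ro i == v]|.

Lemma set_sum_nroots Y : set_sum nroots Y = \sum_i (ro i \in Y).
Proof.
rewrite /set_sum (eq_bigr (fun v => \sum_i (ro i == v))); last first.
  move=> v _; rewrite /nroots -sum1_card big_mkcond; apply: eq_bigr => i _.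
  by rewrite inE; case: (_ == _).
rewrite exchange_big; apply: eq_bigr => i _ /=.
have [Yi|nYi] := boolP (ro i \in Y).
  rewrite (bigD1 (ro i)) //= eqxx big1 // => v /andP[_].
  by rewrite eq_sym => /negPf->.
by rewrite big1 // => v Yv; case: eqP nYi => // ->; rewrite Yv.
Qed.

Lemma nroots_le v : nroots v <= k.
Proof.
rewrite -(regT v); apply: subset_leq_card; apply/subsetP => i.
by rewrite !inE => /eqP<-; case: packT => /(_ i)[].
Qed.

(** Each of the [k] trees through a vertex of [Y] has its root in [Y] or an arc entering [Y], and
    arc-disjointness prevents double counting. *)
Lemma packing_demand Y : Y != set0 ->
  k <= set_sum nroots Y + entering arcT arcH [set Y].
Proof.
case/set0Pn=> y Yy; rewrite -(regT y) set_sum_nroots entering_arcs1.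
have [arbT disT] := packT.
pose ent i a := [&& a \in sg_arcs (T i), arc_head a \in Y & arc_tail a \notin Y].
apply: (@leq_trans (\sum_i (ro i \in Y) + \sum_i \sum_a ent i a)).
  rewrite -big_split -sum1_card big_mkcond; apply: leq_sum => i _ /=.
  rewrite inE; case: ifP => // Tiy; have [//|nYi] := boolP (ro i \in Y).
  have [_ /(_ y Tiy)[p [py _]]] := arbT i.
  have [a [Ta ha ta]] := dipath_enters py nYi Yy.
  by rewrite (bigD1 a) //= /ent Ta ha ta.
rewrite leq_add2l exchange_big; apply: leq_sum => a _.
apply: leq_trans (sum_unique _) _ => [i j /and3P[Tia _ _] /and3P[Tja _ _]|].
  by apply/eqP/idPn => /disT/pred0P/(_ a) /=; rewrite Tia Tja.
by have [/existsP[i /and3P[_ -> ->]]|] := boolP [exists i, ent i a].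
Qed.

(** The single-set bounds add up over [P]: its members are disjoint, so an arc enters at most the
    one containing its head. *)
Lemma feasible_of_packing : feasible k nroots arcT arcH.
Proof.
apply/feasibleP => P sP; have [dP P0] := subpartitionP _ sP.
have [tP _] := andP sP; rewrite mulnC -sum_nat_const.
apply: (@leq_trans (\sum_(Y in P) (set_sum nroots Y + entering arcT arcH [set Y]))).
  by apply: leq_sum => Y PY; apply: packing_demand; apply: contraNneq P0 => <-.
rewrite big_split /= /set_sum big_trivIset // leq_add2l.
rewrite /entering exchange_big; apply: leq_sum => a _.
rewrite enters_some_arc big_mkcond /=.
apply: leq_trans (sum_unique _); last first.
  move=> Y Z /andP[/andP[PY Yh] _] /andP[/andP[PZ Zh] _].
  exact: dP Yh Zh.
apply: leq_sum => Y _; case: ifP => // PY; rewrite enters_some_arc.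
by case: existsP => [[Z /andP[/andP[/set1P-> ->] ->]]|].
Qed.

End Digraphs.

(** * Orienting and trimming a mixed hypergraph *)

Section MixedHypergraphs.
Variables (V : finType) (F : mixed_hypergraph V).
Implicit Type P : {set {set V}}.

Definition mh_tails (d : mh_edge F + mh_dyper F) : {set V} :=
  match d with inl e => mh_vset e | inr a => mh_tail a end.

Definition mh_heads (d : mh_edge F + mh_dyper F) : {set V} :=
  match d with inl e => mh_vset e | inr a => [set mh_head a] end.

Lemma entering_numberE P : entering_number F P = entering mh_tails mh_heads P.
Proof.
rewrite /entering_number /entering big_sumType /= -!sum1_card.
congr (_ + _); rewrite big_mkcond; apply: eq_bigr => d _; rewrite inE.
  by case: ifP => //; rewrite /enters_some /hyperedge_enters => ->.
set b := [exists Y in P, _]; suff -> : enters_some (mh_tail d) [set mh_head d] P = b.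
  by case: b.
apply: eq_existsb => Y; rewrite /dyperedge_enters; congr (_ && (_ && _)).
apply/set0Pn/idP => [[x /setIP[/set1P->]]|Yh] //.
by exists (mh_head d); rewrite inE set11.
Qed.

Lemma trimmable_mh d : trimmable (mh_tails d) (mh_heads d).
Proof. by case: d => [e|a]; [left | right; exists (mh_head a)]. Qed.

Lemma mh_heads_neq0 d : mh_heads d != set0.
Proof.
case: d => [e|a] /=; last by apply/set0Pn; exists (mh_head a); rewrite set11.
by rewrite -card_gt0 ltnW // mh_vset_gt1.
Qed.

Lemma entering_trim_le (o : mh_edge F -> V) (t : dy_edge (orient o) -> V) P :
  is_orientation o -> is_trimming t ->
  entering (fun a : Defs.arc (trim t) => [set arc_tail a])
           (fun a : Defs.arc (trim t) => [set arc_head a]) P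
    <= entering mh_tails mh_heads P.
Proof.
move=> oP tP; apply: leq_sum => d _.
have [/enters_someP[Y [_ [_ [PY /set1P-> Yh /set1P-> nYt]]]]|//] :=
  boolP (enters_some _ [set arc_head d] P).
suff -> : enters_some (mh_tails d) (mh_heads d) P by [].
apply/enters_someP; exists Y, (orient_head o d), (t d); split=> //.
  by case: (d) => [e|a] /=; [apply: oP | rewrite set11].
by have := tP d; case: (d) => [e /setD1P[]|a].
Qed.

Lemma feasible_mh_packing k r f g l l' : (forall v, r v <= k) ->
  (forall v, f v <= r v <= g v) -> l <= set_sum r [set: V] <= l' ->
  feasible k r mh_tails mh_heads ->
  has_mixed_hyperarborescence_packing F f g k l l'.
Proof.
move=> rk frg lrl feas.
have [h [hP feas_h]] := feasible_choose_heads trimmable_mh mh_heads_neq0 feas.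
pose o e := h (inl e).
have oP : is_orientation o by move=> e; apply: hP.
have hE d : h d = orient_head o d.
  by case: d => [e|a] //=; have := hP (inr a) => /set1P.
exists o; split=> //.
(* Orienting deletes the chosen head from the tail set. No entering is lost, since a tail outside
   [Y] differs from a head inside [Y]. *)
have feas_o : feasible k r (@dy_tail V (orient o)) (fun d => [set h d]).
  apply/feasibleP => P sP; apply: leq_trans (feasibleP _ _ _ _ feas_h P sP) _.
  rewrite leq_add2l; apply: leq_sum => d _.
  have [/enters_someP[Y [_ [t [PY /set1P-> Yh Tt nYt]]]]|//] :=
    boolP (enters_some _ _ P).
  suff -> : enters_some (@dy_tail V (orient o) d) [set h d] P by [].
  apply/enters_someP; exists Y, (h d), t; split; rewrite ?set11 //.
  case: d Yh Tt => [e|a] //= Yh Tt; rewrite !inE Tt andbT.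
  by apply: contraNneq nYt => ->.
have [t [tP feas_t]] := feasible_choose_tails (@dy_tail_neq0 V (orient o)) feas_o.
exists t; split=> //.
have [|m [T [ro [pT rT kT mT]]]] := @packing_of_demand V (trim t) k r rk.
  move=> X X0; have := feasibleP _ _ _ _ feas_t _ (subpartition1 X0).
  rewrite cards1 muln1 cover1 -entering_arcs1.
  congr (_ <= _ + _); apply: eq_bigr => d _.
  by rewrite hE.
exists m, T, ro; split=> //; first by move=> v; rewrite rT.
by rewrite /limited_packing mT.
Qed.

End MixedHypergraphs.

Lemma set_sum_le (V : finType) (h h' : V -> nat) X :
  (forall v, h v <= h' v) -> set_sum h X <= set_sum h' X.
Proof. by move=> le_h; apply: leq_sum. Qed.

(** Splits condition (iii) into the half that allows lowering the number of roots to [l'] and the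
    half that is feasibility of [gk]. *)
Lemma deficiency_le (a b c d e : nat) :
  ((a%:Z - Num.min (b%:Z - c%:Z) d%:Z <= e%:Z)%R) =
    ((a + c <= e + b) && (a <= d + e)).
Proof. lia. Qed.

Theorem theorem16 (V : finType) (F : mixed_hypergraph V) (f g : V -> nat)
    (k l l' : nat) (hk : 0 < k) (hl : 0 < l) (hl' : 0 < l') :
  let gk := fun v : V => minn k (g v) in
  has_mixed_hyperarborescence_packing F f g k l l' <->
  [/\ forall v : V, f v <= gk v,
      l <= minn (set_sum gk [set: V]) l' &
      forall P : {set {set V}}, subpartition P ->
        ((k * #|P|)%:Z
           - Num.min (l'%:Z - (set_sum f (~: cover P))%:Z)
                     (set_sum gk (cover P))%:Z
         <= (entering_number F P)%:Z)%R].
Proof.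
move=> gk; split=> [[o [oP [t [tP [m [T [ro [pT bT kT /andP[lm ml']]]]]]]]]|].
  pose r v := #|[set i | ro i == v]|.
  have frg v : f v <= r v <= gk v.
    by have /andP[-> ?] := bT v; rewrite leq_min (nroots_le pT kT).
  have rgk v : r v <= gk v by case/andP: (frg v).
  have mE : set_sum r [set: V] = m.
    rewrite set_sum_nroots (eq_bigr (fun _ => 1)) ?sum1_card ?card_ord // => i _.
    by rewrite inE.
  split=> [v||P sP].
  - by case/andP: (frg v) => /leq_trans; apply.
  - by rewrite leq_min (leq_trans lm ml') andbT (leq_trans lm) // -mE set_sum_le.
  have := feasibleP _ _ _ _ (feasible_of_packing pT kT) P sP.
  move/leq_trans/(_ (leq_add (leqnn _) (entering_trim_le P oP tP))).
  rewrite -entering_numberE -/r deficiency_le.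
  have := set_sum_le (cover P) rgk.
  (* At least [f] of the at most [l'] roots lie outside the cover, which bounds the number
     inside. *)
  have : set_sum f (~: cover P) <= set_sum r (~: cover P).
    by apply: set_sum_le => v; case/andP: (frg v).
  have : set_sum r [set: V] = set_sum r (cover P) + set_sum r (~: cover P).
    by rewrite /set_sum (big_setID (cover P)) setTI -setTD.
  rewrite mE; move: ml'; clear; move: (entering_number _ _) (k * _).
  move: (set_sum gk _) (set_sum f _) (set_sum r _) (set_sum r _); lia.
case=> fgk; rewrite leq_min => /andP[lgk ll'] condP.
have [||r [frg lrl feas]] := @feasible_choose_roots _ _ k _ _ f gk l l'
  (@trimmable_mh V F) fgk lgk ll'.
- apply/feasibleP => P sP; have := condP P sP; rewrite deficiency_le.
  by rewrite entering_numberE => /andP[].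
- move=> P sP; have := condP P sP; rewrite deficiency_le.
  by rewrite entering_numberE => /andP[].
apply: (feasible_mh_packing _ _ lrl feas) => v.
  by case/andP: (frg v) => _; rewrite leq_min => /andP[].
by case/andP: (frg v) => ->; rewrite leq_min => /andP[].
Qed.
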